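(* Let $u:\mathbb{Z}_+^2\setminus\{(0,0)\}\to\mathbb{R}_+$ be a mass function that is eventually decreasing in both arguments and that is regularly varying in the following sense: there exist $\rho<0$, a function $h\in RV_\rho$ and a function $\lambda$ on $(0,\infty)^2$ such that $$\lim_{n\to\infty}\frac{u([nx],[ny])}{h(n)}=\lambda(x,y)>0\qquad\text{for all } x,y>0 ,$$ where $n$ runs through the positive integers. Then the function $g(x,y):=u([x],[y])$ is eventually decreasing and regularly varying, with $$\lim_{t\to\infty}\frac{g(tx,ty)}{h(t)}=\lambda(x,y)\qquad\text{for all } x,y>0,$$ where $t$ runs through the positive reals; so $u$ is embeddable in the regularly varying function $g$.
   Context: $\mathbb{Z}_+=\{0,1,2,\dots\}$, $\mathbb{R}_+=[0,\infty)$, and $[x]$ is the largest integer $\le x$. For $\rho\in\mathbb{R}$, $h\in RV_\rho$ means that $h:(0,\infty)\to(0,\infty)$ is measurable and $\lim_{t\to\infty}h(tx)/h(t)=x^\rho$ for all $x>0$. A mass function here is a non-negative function on the lattice points. ''Eventually decreasing in both arguments'' means: there is $M$ such that on the region where both arguments are at least $M$ the function is non-increasing in each argument separately. A measurable function $g$ on $\mathbb{R}_+^2$ is (standard) regularly varying with limit function $\lambda$ if there is $h\in RV_\alpha$ for some $\alpha\in\mathbb{R}$ such that $\lim_{t\to\infty} g(tx,ty)/h(t)=\lambda(x,y)>0$ for all $x,y>0$. The doubly indexed function $u$ is embeddable if $g(x,y):=u([x],[y])$ is a regularly varying function in this sense. The function $g$ is considered at points $(x,y)$ with $([x],[y])\ne(0,0)$.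 *)

(* Defs.v *)
From mathcomp Require Import all_boot all_order all_algebra.
From mathcomp Require Import all_classical all_reals all_analysis.

Set Implicit Arguments.
Unset Strict Implicit.
Unset Printing Implicit Defensive.

Import Order.TTheory GRing.Theory Num.Theory.
Import numFieldNormedType.Exports.

Local Open Scope classical_set_scope.
Local Open Scope ring_scope.

Definition RV (R : realType) (rho : R) (h : R -> R) : Prop :=
  [/\ measurable_fun [set x : R | 0 < x] h,
      (forall x, 0 < x -> 0 < h x) &
      forall x, 0 < x -> h (t * x) / h t @[t --> +oo] --> x `^ rho].

(* Functions on a subset D of T * T are represented by total functions on
   T * T; their values outside D are irrelevant. *)
Definition eventually_decreasing (disp : Order.disp_t) (T : porderType disp)
    (R : realType) (D : set (T * T)) (f : T -> T -> R) : Prop :=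
  exists M : T,
    (forall x x' y : T, (M <= x)%O -> (M <= y)%O -> (x <= x')%O ->
       D (x, y) -> D (x', y) -> f x' y <= f x y) /\
    (forall x y y' : T, (M <= x)%O -> (M <= y)%O -> (y <= y')%O ->
       D (x, y) -> D (x, y') -> f x y' <= f x y).

Definition regularly_varying (R : realType) (D : set (R * R))
    (g lambda : R -> R -> R) : Prop :=
  measurable_fun D (fun p => g p.1 p.2) /\
  exists (alpha : R) (h : R -> R), RV alpha h /\
    forall x y, 0 < x -> 0 < y ->
      0 < lambda x y /\
      g (t * x) (t * y) / h t @[t --> +oo] --> lambda x y.

Definition lattice_domain : set (nat * nat) :=
  [set p | p <> (0%N, 0%N)].

Definition mass_function (R : realType) (u : nat -> nat -> R) : Prop :=
  forall m n : nat, lattice_domain (m, n) -> 0 <= u m n.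

(* On nonnegative reals, Num.truncn is the integer part, as a natural number. *)
Definition embedding_domain (R : realType) : set (R * R) :=
  [set p | [/\ 0 <= p.1, 0 <= p.2 &
               lattice_domain (Num.truncn p.1, Num.truncn p.2)]].

Definition embedding (R : realType) (u : nat -> nat -> R) (x y : R) : R :=
  u (Num.truncn x) (Num.truncn y).

Definition embeddable (R : realType) (u : nat -> nat -> R) : Prop :=
  exists lambda : R -> R -> R,
    regularly_varying (@embedding_domain R) (embedding u) lambda.

(* Main.v *)
(* For [t] with integer part [k], eventual monotonicity of [u] sandwiches
   [g (t x, t y)] between its values at [k + 1] and at [k].  The limit along the
   integers gives the asymptotics of both bounds against [h (k + 1)] and [h k],
   so everything reduces to [h a / h t --> 1] when [`|a - t| <= 1].  This is the
   one place where measurability of [h] is needed: it is Karamata's uniform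
   convergence theorem, applied to [F x = ln (h (expR x)) - rho * x], whose
   increments [F (x + v) - F x] tend to [0] for each fixed [v].  By Egorov's
   theorem this convergence is uniform outside sets of small measure, which is
   enough by translation invariance of the Lebesgue measure. *)

Require Import Defs.
From mathcomp Require Import all_boot all_order all_algebra.
From mathcomp Require Import all_classical all_reals all_analysis.
From mathcomp Require Import measurable_realfun ring lra.

Set Implicit Arguments.
Unset Strict Implicit.
Unset Printing Implicit Defensive.

Import Order.TTheory GRing.Theory Num.Theory.
Import numFieldNormedType.Exports.

Local Open Scope classical_set_scope.
Local Open Scope ring_scope.

(** * Translation invariance and uniform convergence of increments *)

Lemma lebesgue_measure_shift (R : realType) (d : R) (A : set R) :
  measurable A ->
  lebesgue_measure ((fun x : R => x + d) @^-1` A) = lebesgue_measure A.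
Proof.
have mshift : measurable_fun [set: R]
    ((fun x => x + d) : R -> measurableTypeR R).
  exact: measurable_funD.
move=> mA; apply/esym.
(* The pushforward under a translation is a measure that agrees with Lebesgue measure on the
   intervals []a, b]], and these determine it. *)
have -> : lebesgue_measure ((fun x : R => x + d) @^-1` A) =
    pushforward lebesgue_measure ((fun x => x + d) : R -> measurableTypeR R) A.
  by [].
apply: lebesgue_measure_unique => //= _ [[a b]] _ <-.
rewrite /pushforward.
have -> : (fun x => x + d) @^-1` `]a, b] = `](a - d), (b - d)]%classic.
  by apply/seteqP; split => x /=; rewrite !in_itv/= ltrBlDr lerBrDr.
rewrite !lebesgue_measure_itv/= !lte_fin ltrD2r.
by case: ifP => // _; rewrite -!EFinB; congr (_%:E); rewrite opprB addrA subrK.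
Qed.

(** Egorov's theorem on [[0, 1]] for the functions [F (x_ n + v) - F (x_ n)] of [v], which tend to
    [0] pointwise. One set [B] serves all large [n], but it depends on the sequence [x_]. *)
Lemma increments_small_off_small_set (R : realType) (F : R -> R) (x_ : R^nat)
    (eps eta : R) :
  measurable_fun [set: R] F ->
  (forall v, F (x + v) - F x @[x --> +oo] --> 0) ->
  x_ @ \oo --> +oo -> 0 < eps -> 0 < eta ->
  exists B : set R, [/\ measurable B, (lebesgue_measure B < eta%:E)%E &
    \forall n \near \oo, forall v, 0 <= v <= 1 -> ~ B v ->
      `|F (x_ n + v) - F (x_ n)| < eps].
Proof.
move=> mF F_slow xoo e0 eta0.
pose f n v := F (x_ n + v) - F (x_ n).
pose A := `[0, 1]%classic : set R.
have mA : measurable A by exact: measurable_itv.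
have mf n : measurable_fun A (f n).
  apply: measurable_funB => //.
  apply: (measurable_comp measurableT) => //.
  exact: measurable_funD.
have fin01 : (lebesgue_measure (`[0%R, 1%R]%classic : set R) < +oo)%E.
  by rewrite lebesgue_measure_itv/= lte_fin ltr01 -EFinB ltry.
have f0 v : A v -> f ^~ v @ \oo --> (cst 0 : R -> R) v.
  by move=> _; move/cvg_pinftyP : (F_slow v); apply.
have [B [mB Beta Bunif]] :=
  @pointwise_almost_uniform _ R _ lebesgue_measure _ _ _ _ mf mA fin01 f0 eta0.
exists B; split => //.
have /Bunif : nbhs (cst 0 : {uniform` A `\` B -> R})
    [set g : R -> R | forall v, (A `\` B) v -> ball (0 : R) eps (g v)].
  apply/uniform_nbhs; exists [set p : R * R | ball p.1 eps p.2]; split => //.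
  exact: entourage_ball (PosNum e0).
apply: (@filterS _ \oo) => n /= fB v v01 Bv.
have := fB v; rewrite /ball/= sub0r normrN; apply.
by split => //=; rewrite in_itv.
Qed.

(* The two sequences are compared through a common intermediate point
   [x_ n + v = y_ n + w] at which both increments are small. *)
Lemma slow_variation_asymp (R : realType) (F : R -> R) (x_ y_ : R^nat) :
  measurable_fun [set: R] F ->
  (forall v, F (x + v) - F x @[x --> +oo] --> 0) ->
  x_ @ \oo --> +oo -> y_ @ \oo --> +oo -> x_ n - y_ n @[n --> \oo] --> 0 ->
  F (x_ n) - F (y_ n) @[n --> \oo] --> 0.
Proof.
move=> mF F_slow xoo yoo xy0.
(* The margin [4^-1] on both sides keeps [v + d] in [[0, 1]] for [v] in [I] once [|d| < 4^-1]. Two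
   exceptional sets of measure below [8^-1] cannot cover [I], whose measure is [2^-1]. *)
pose I := `[4^-1, 3 / 4]%classic : set R.
have muI : lebesgue_measure I = (2^-1)%:E.
  rewrite lebesgue_measure_itv/= lte_fin ifT; last lra.
  by rewrite -EFinB; congr (_%:E); lra.
have num : 8^-1 + 8^-1 < 2^-1 :> R by lra.
apply/cvgrPdist_lt => e e0.
have e2 : 0 < e / 2 by rewrite divr_gt0.
have q8 : 0 < 8^-1 :> R by rewrite invr_gt0.
have [B [mB Bq HB]] := increments_small_off_small_set mF F_slow xoo e2 q8.
have [C [mC Cq HC]] := increments_small_off_small_set mF F_slow yoo e2 q8.
have q4 : 0 < 4^-1 :> R by rewrite invr_gt0.
near=> n.
have Bn : forall v, 0 <= v <= 1 -> ~ B v -> `|F (x_ n + v) - F (x_ n)| < e / 2.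
  by near: n.
have Cn : forall v, 0 <= v <= 1 -> ~ C v -> `|F (y_ n + v) - F (y_ n)| < e / 2.
  by near: n.
set d := x_ n - y_ n.
have dq : `|d| < 4^-1.
  rewrite -normrN -sub0r /d; near: n.
  by move/cvgrPdist_lt : xy0; apply.
(* The shift [d] varies with [n], but [Cd] is a translate of the fixed set [C], so its measure stays
   below [8^-1] for every [n]. *)
pose Cd := (fun v : R => v + d) @^-1` C.
have [v [vI Bv Cv]] :
    exists v, [/\ I v, ~ B v & ~ C (v + d)].
  apply: contrapT => /forallNP noV.
  have /(le_measure (@lebesgue_measure R)) :
      I `<=` B `|` Cd.
    move=> v vI; have [Bv|Bv] := pselect (B v); first by left.
    by right; apply: contrapT => Cv; apply: (noV v).
  have mC' : measurable Cd.
    rewrite -[X in measurable X]setTI; apply: (_ : measurable_fun setT _) => //.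
    exact: measurable_funD.
  rewrite !inE => /(_ (measurable_itv _) (measurableU _ _ mB mC')).
  have BC : (lebesgue_measure (B `|` Cd) <
      8^-1%:E + 8^-1%:E)%E.
    apply: (@le_lt_trans _ _
      (lebesgue_measure B + lebesgue_measure Cd)%E).
      exact: measureU2.
    rewrite lebesgue_measure_shift//.
    exact: lteD Bq Cq.
  apply/negP; rewrite -ltNge; apply: (lt_trans BC).
  by rewrite /= muI -EFinD lte_fin.
move: vI; rewrite /I/= in_itv/= => /andP[v1 v2].
move: dq; rewrite ltr_norml => /andP[d1 d2].
have vb : 0 <= v <= 1 by lra.
have vd : 0 <= v + d <= 1 by lra.
have := Bn v vb Bv; have := Cn _ vd Cv.
have -> : y_ n + (v + d) = x_ n + v by rewrite /d; lra.
by rewrite !ltr_norml => /andP[? ?] /andP[? ?]; lra.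
Unshelve. all: by end_near.
Qed.

(** * Ratios of a regularly varying function along sequences *)

Lemma expR_cvgry (R : realType) : (@expR R) @ +oo --> +oo.
Proof.
apply/cvgryPge => A; near=> x.
apply: (le_trans _ (expR_ge1Dx x)).
rewrite -lerBlDl; near: x; exact: nbhs_pinfty_ge (num_real _).
Unshelve. all: by end_near. Qed.

Lemma ln_cvgry (R : realType) : (@ln R) @ +oo --> +oo.
Proof.
apply/cvgryPge => A; near=> x.
have Ax : expR A <= x by near: x; exact: nbhs_pinfty_ge (num_real _).
by rewrite -[A]expRK ler_ln// posrE ?expR_gt0// (lt_le_trans _ Ax)// expR_gt0.
Unshelve. all: by end_near. Qed.

(** Logarithms turn [a n / b n --> 1] into [ln (a n) - ln (b n) --> 0], the setting of
    [slow_variation_asymp]. *)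
Lemma RV_ratio_cvg1 (R : realType) (rho : R) (h : R -> R) (a b : R^nat) :
  RV rho h -> a @ \oo --> +oo -> b @ \oo --> +oo ->
  a n / b n @[n --> \oo] --> (1 : R) ->
  h (a n) / h (b n) @[n --> \oo] --> (1 : R).
Proof.
move=> [mh h0 hrho] aoo boo ab1.
pose F (x : R) := ln (h (expR x)) - rho * x.
have mF : measurable_fun [set: R] F.
  apply: measurable_funB; last exact: measurable_funM.
  apply: measurableT_comp => //; apply: (measurable_comp _ _ mh) => //.
  - rewrite (_ : [set x : R | 0 < x] = `]0, +oo[%classic)//.
    by apply/seteqP; split => x /=; rewrite in_itv/= andbT.
  - by move=> _ [x _ <-] /=; exact: expR_gt0.
have Fslow v : F (x + v) - F x @[x --> +oo] --> 0.
  (* The increment is the logarithm of the quotient in the definition of [RV], at the point [expR x]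
     with factor [expR v], centred by its limit [rho * v]. *)
  have -> : (fun x => F (x + v) - F x) =
      (fun x => ln (h (expR x * expR v) / h (expR x)) - rho * v).
    apply/funext => x; rewrite /F expRD ln_div ?posrE ?h0 ?mulr_gt0 ?expR_gt0//.
    by rewrite mulrDr; ring.
  rewrite -(subrr (rho * v)); apply: cvgB; last exact: cvg_cst.
  have -> : rho * v = ln (expR v `^ rho) by rewrite ln_powR expRK.
  have hx := cvg_comp _ _ (@expR_cvgry R) (hrho _ (expR_gt0 v)).
  apply: (cvg_comp _ _ hx).
  by apply: continuous_ln; rewrite powR_gt0// expR_gt0.
have a0 : \forall n \near \oo, 0 < a n by move/cvgryPgt : aoo; apply.
have b0 : \forall n \near \oo, 0 < b n by move/cvgryPgt : boo; apply.
have lnab : ln (a n / b n) @[n --> \oo] --> (0 : R).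
  rewrite -ln1; apply: (cvg_comp _ _ ab1).
  exact: continuous_ln.
have lndiff : ln (a n) - ln (b n) @[n --> \oo] --> (0 : R).
  apply: cvg_trans lnab; apply: near_eq_cvg; near=> n.
  rewrite ln_div ?posrE//; by [near: n|near: n].
have lnoo (c : R^nat) : c @ \oo --> +oo -> ln (c n) @[n --> \oo] --> +oo.
  by move=> coo; exact: (cvg_comp _ _ coo (@ln_cvgry R)).
have FF := slow_variation_asymp mF Fslow (lnoo _ aoo) (lnoo _ boo) lndiff.
(* Adding back the linear term that [F] removes gives, for large [n], the logarithm of
   [h (a n) / h (b n)]; exponentiating then recovers the ratio. *)
have sum0 : F (ln (a n)) - F (ln (b n)) + rho * ln (a n / b n)
    @[n --> \oo] --> 0 + rho * 0.
  by apply: cvgD => //; apply: cvgM => //; exact: cvg_cst.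
rewrite mulr0 addr0 in sum0.
have := cvg_comp _ _ sum0 (@continuous_expR R 0).
rewrite expR0.
apply: cvg_trans; apply: near_eq_cvg; near=> n.
have an : 0 < a n by near: n.
have bn : 0 < b n by near: n.
rewrite /= /F !lnK ?posrE// ln_div ?posrE//.
have -> : ln (h (a n)) - rho * ln (a n) - (ln (h (b n)) - rho * ln (b n)) +
    rho * (ln (a n) - ln (b n)) = ln (h (a n)) - ln (h (b n)) by ring.
by rewrite -ln_div ?posrE ?h0// lnK// posrE divr_gt0// h0.
Unshelve. all: by end_near. Qed.

(** The quotient [a n / t n] differs from [1] by at most [1 / t n]. This serves for the two integers
    that enclose [t n]. *)
Lemma RV_bounded_shift (R : realType) (rho : R) (h : R -> R) (a t : R^nat) :
  RV rho h -> t @ \oo --> +oo -> (\forall n \near \oo, `|a n - t n| <= 1) ->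
  h (a n) / h (t n) @[n --> \oo] --> (1 : R).
Proof.
move=> hRV too at1.
apply: (RV_ratio_cvg1 hRV) => //.
  apply/cvgryPge => A; near=> n.
  have : `|a n - t n| <= 1 by near: n.
  have : A + 1 <= t n by near: n; move/cvgryPge : too; apply.
  by rewrite ler_norml => ? /andP[? _]; lra.
apply/cvgrPdist_le => e e0; near=> n.
have tn : `|a n - t n| <= 1 by near: n.
have tn0 : 0 < t n by near: n; move/cvgryPgt : too; apply.
have te : e^-1 <= t n by near: n; move/cvgryPge : too; apply.
rewrite -[X in X - _](divff (lt0r_neq0 tn0)) -mulrBl normrM distrC.
rewrite normfV (gtr0_norm tn0) ler_pdivrMr// (le_trans tn)//.
by rewrite mulrC -ler_pdivrMr// div1r.
Unshelve. all: by end_near. Qed.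

(** * Measurability and monotonicity of the embedding *)

Lemma measurable_truncn_fiber (R : realType) (i : nat) :
  measurable [set x : R | Num.truncn x = i].
Proof.
(* [Num.truncn] is [0] on negative reals, hence nondecreasing on the whole line. *)
have mt : measurable_fun [set: R] (fun x : R => (Num.truncn x)%:R : R).
  by apply: nondecreasing_measurable => // x y xy; rewrite ler_nat le_truncn.
have -> : [set x : R | Num.truncn x = i] =
    [set: R] `&` (fun x : R => (Num.truncn x)%:R : R) @^-1` [set i%:R].
  rewrite setTI; apply/seteqP; split => x /= => [-> //|].
  by move/eqP; rewrite eqr_nat => /eqP.
exact: mt.
Qed.

(** The embedding is constant on each product of two fibers of [Num.truncn], so every preimage is a
    countable union of measurable rectangles. *)
Lemma measurable_embedding (R : realType) (u : nat -> nat -> R)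
    (D : set (R * R)) : measurable_fun D (fun p => embedding u p.1 p.2).
Proof.
apply: measurable_funTS => _ Y _; rewrite setTI.
pose fiber i := [set x : R | Num.truncn x = i].
have -> : (fun p : R * R => embedding u p.1 p.2) @^-1` Y =
    \bigcup_i \bigcup_j
      if u i j \in Y then fiber i `*` fiber j else set0.
  apply/seteqP; split => [[x y] /= Yxy|[x y] /= [i _] [j _]].
    exists (Num.truncn x) => //; exists (Num.truncn y) => //.
    by rewrite mem_set.
  by case: ifPn => // /set_mem Yij [/= xi yj]; rewrite /embedding xi yj.
apply: bigcupT_measurable => i; apply: bigcupT_measurable => j.
by case: ifP => // _; apply: measurableX; exact: measurable_truncn_fiber.
Qed.

Lemma eventually_decreasing_embedding (R : realType) (u : nat -> nat -> R) :
  eventually_decreasing lattice_domain u ->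
  eventually_decreasing (@embedding_domain R) (embedding u).
Proof.
move=> [M [ux uy]]; exists M%:R.
have trM (x : R) : M%:R <= x -> (M <= Num.truncn x)%N.
  by move=> Mx; rewrite truncn_ge_nat// (le_trans _ Mx).
split=> [x x' y Mx My xx' [_ _ D] [_ _ D']|x y y' Mx My yy' [_ _ D] [_ _ D']].
  by apply: ux => //; [exact: trM|exact: trM|exact: le_truncn].
by apply: uy => //; [exact: trM|exact: trM|exact: le_truncn].
Qed.

(** The path from [(m, n)] to [(m', n')] goes through [(m', n)]. The strict bounds make the
    coordinates positive, so it avoids the excluded origin even when [M] is [0]. *)
Lemma eventually_decreasing_both (R : realType) (u : nat -> nat -> R) :
  eventually_decreasing lattice_domain u ->
  exists M : nat, forall m m' n n' : nat,
    (M < m)%N -> (M < n)%N -> (m <= m')%N -> (n <= n')%N -> u m' n' <= u m n.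
Proof.
move=> [M [ux uy]]; exists M => m m' n n' Mm Mn mm' nn'.
have dom k l : (M < k)%N -> lattice_domain (k, l).
  by move=> Mk [k0]; rewrite k0 in Mk.
have Mm' := leq_trans Mm mm'.
apply: (@le_trans _ _ (u m' n)).
  by apply: uy => //; [exact: ltnW|exact: ltnW|exact: dom|exact: dom].
by apply: ux => //; [exact: ltnW|exact: ltnW|exact: dom|exact: dom].
Qed.

(** * Passage from integer to real arguments *)

Theorem theorem3p1 (R : realType) (u : nat -> nat -> R)
    (rho : R) (h : R -> R) (lambda : R -> R -> R)
    (u_mass : mass_function u)
    (u_decr : eventually_decreasing lattice_domain u)
    (rho_lt0 : rho < 0)
    (h_RV : RV rho h)
    (lambda_gt0 : forall x y : R, 0 < x -> 0 < y -> 0 < lambda x y)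
    (u_lim : forall x y : R, 0 < x -> 0 < y ->
       (fun n : nat =>
          u (Num.truncn (n%:R * x)) (Num.truncn (n%:R * y)) / h n%:R) @ \oo
         --> lambda x y) :
  [/\ eventually_decreasing (@embedding_domain R) (embedding u),
      regularly_varying (@embedding_domain R) (embedding u) lambda,
      (forall x y : R, 0 < x -> 0 < y ->
         embedding u (t * x) (t * y) / h t @[t --> +oo] --> lambda x y) &
      embeddable u].
Proof.
have lim x y : 0 < x -> 0 < y ->
    embedding u (t * x) (t * y) / h t @[t --> +oo] --> lambda x y.
  move=> x0 y0; apply/cvg_pinftyP => t too.
  have h0 : forall z, 0 < z -> 0 < h z by case: h_RV.
  pose k n := Num.truncn (t n).
  have koo : k @ \oo --> \oo.
    apply/cvgnyPge => N; near=> n; rewrite truncn_ge_nat.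
      by near: n; move/cvgryPge : too; apply.
    by near: n; move/cvgryPge : too; apply.
  have kroo : (fun n => (k n)%:R : R) @ \oo --> +oo by apply/cvgrnyP.
  have k1oo : (fun n => (k n).+1) @ \oo --> \oo.
    apply/cvgnyPge => N; near=> n; apply: leqW.
    by near: n; move/cvgnyPge : koo; apply.
  have kt : \forall n \near \oo, (k n)%:R <= t n < (k n).+1%:R.
    near=> n; apply: truncn_itv.
    by near: n; move/cvgryPge : too; apply.
  have lim_along (j : nat -> nat) : j @ \oo --> \oo ->
      (\forall n \near \oo, `|(j n)%:R - t n| <= 1) ->
      embedding u ((j n)%:R * x) ((j n)%:R * y) / h (t n)
        @[n --> \oo] --> lambda x y.
    move=> joo jt.
    have hj := RV_bounded_shift h_RV too jt.
    (* The first factor is the limit hypothesis reindexed by [j]; the second tends to [1] and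
       exchanges [h (j n)] for [h (t n)]. *)
    have uj : embedding u ((j n)%:R * x) ((j n)%:R * y) / h (j n)%:R *
        (h (j n)%:R / h (t n)) @[n --> \oo] --> lambda x y.
      rewrite -[lambda x y]mulr1; apply: cvgM hj.
      exact: (cvg_comp _ _ joo (u_lim x y x0 y0)).
    apply: cvg_trans uj; apply: near_eq_cvg; near=> n.
    have j0 : (0 < j n)%N by near: n; move/cvgnyPgt : joo; apply.
    rewrite /= /embedding mulrA divfK//.
    by rewrite gt_eqF// h0// ltr0n.
  have [M uM] := eventually_decreasing_both u_decr.
  apply: (squeeze_cvgr _ (lim_along _ k1oo _) (lim_along _ koo _)).
  - near=> n.
    have /andP[kt1 tk1] : (k n)%:R <= t n < (k n).+1%:R by near: n.
    (* Beyond [M.+1%:R / z] the integer part of [(k n)%:R * z] exceeds [M]. Checking this at [k n]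
       suffices, since the arguments at [t n] and [(k n).+1] are at least as large. *)
    have kM (z : R) : 0 < z -> M.+1%:R / z <= (k n)%:R ->
        (M < Num.truncn ((k n)%:R * z))%N.
      by move=> z0; rewrite ler_pdivrMr// => kz; rewrite truncn_gt_nat.
    have kx : (M < Num.truncn ((k n)%:R * x))%N.
      apply: kM => //; near: n.
      by move/cvgryPge : kroo; apply.
    have ky : (M < Num.truncn ((k n)%:R * y))%N.
      apply: kM => //; near: n.
      by move/cvgryPge : kroo; apply.
    have ht : 0 <= (h (t n))^-1.
      rewrite invr_ge0 ltW// h0//.
      by near: n; move/cvgryPgt : too; apply.
    have xt : (Num.truncn ((k n)%:R * x) <= Num.truncn (t n * x))%N.
      by rewrite le_truncn// ler_wpM2r// ltW.
    have yt : (Num.truncn ((k n)%:R * y) <= Num.truncn (t n * y))%N.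
      by rewrite le_truncn// ler_wpM2r// ltW.
    apply/andP; split; rewrite ler_wpM2r//; apply: uM => //.
    + exact: leq_trans xt.
    + exact: leq_trans yt.
    + by rewrite le_truncn// ler_wpM2r// ltW.
    + by rewrite le_truncn// ler_wpM2r// ltW.
  - near=> n.
    have /andP[] : (k n)%:R <= t n < (k n).+1%:R by near: n.
    by rewrite ler_norml -natr1 => ? ?; lra.
  - near=> n.
    have /andP[] : (k n)%:R <= t n < (k n).+1%:R by near: n.
    by rewrite ler_norml -natr1 => ? ?; lra.
have rv : regularly_varying (@embedding_domain R) (embedding u) lambda.
  split; first exact: measurable_embedding.
  by exists rho, h; split=> // x y x0 y0; split; [exact: lambda_gt0|exact: lim].
by split; [exact: eventually_decreasing_embedding| | |exists lambda].
Unshelve. all: by end_near. Qed.
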